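(* Let $N$ be a positive integer and $t_{\min}\le t_{\max}$ real numbers. Let $Nam_N$, $Nam_N/{\cong}$ and $conv(C_N)$ have their usual topologies. Then $F_{QNam}$ is a homeomorphism from $Nam_N/{\cong}$ to $conv(C_N)$.
   Context: $C_N(t)=(t,t^2,\dots,t^N)\in\mathbb{R}^N$ for $t\in[t_{\min},t_{\max}]$, and $conv(C_N)$ is the convex hull of the image of this map, with the subspace topology from Euclidean $\mathbb{R}^N$ (its usual topology). Namings: for a positive integer $M$, an $M$-naming (of the point $v$) is a tuple $(c_1,\dots,c_M,t_1,\dots,t_M)\in\mathbb{R}^{2M}$ with $c_j\ge 0$, $\sum_{j=1}^M c_j=1$, $t_{\min}\le t_1\le\dots\le t_M\le t_{\max}$ (and $\sum_{j=1}^M c_jC_N(t_j)=v$). The pair $(c_j,t_j)$ is the $j$-th term, with coefficient $c_j$ and point $C_N(t_j)$. An $(M-\frac12)$-naming is an $M$-naming with $t_1=t_{\min}$. Equivalence: a positive integer or half-integer $M'$ is of the correct parity for $N$ if $M'-\frac{N+1}{2}$ is an integer, and an $M'$-naming with such $M'$ is a correct-parity-for-$N$ naming (so for $N$ odd these are the $M$-namings with $M$ any positive integer; for $N$ even these are the $M$-namings with $t_1=t_{\min}$). A zero-addition of a naming is the same naming with one extra term with coefficient $0$ inserted (keeping the $t_j$ in nondecreasing order). An equal-split of a naming is the same naming with one term $(c,t)$ replaced by two terms $(c',t),(c'',t)$ with $c',c''\ge0$, $c'+c''=c$. Two correct-parity-for-$N$ namings are directly equivalent if one of them is a zero-addition or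 an equal-split of the other. Two correct-parity-for-$N$ namings $P_1,P_2$ are equivalent, $P_1\cong P_2$, if there is a finite sequence of correct-parity-for-$N$ namings (of possibly varying sizes) from $P_1$ to $P_2$ in which any two adjacent entries are directly equivalent (a one-entry sequence is allowed). Spaces and map: let $M=\frac{N+1}{2}$ if $N$ is odd and $M=\frac{N+2}{2}$ if $N$ is even. $Nam_N\subset\mathbb{R}^{2M}$ is the set of all $\frac{N+1}{2}$-namings, with the subspace topology from Euclidean $\mathbb{R}^{2M}$. $Nam_N/{\cong}$ is the set of equivalence classes of elements of $Nam_N$ under $\cong$, with the quotient topology. $F_{Nam}:Nam_N\to conv(C_N)$ is $F_{Nam}(c_1,\dots,c_M,t_1,\dots,t_M)=\sum_{j=1}^M c_jC_N(t_j)$, and $F_{QNam}:Nam_N/{\cong}\to conv(C_N)$ is the map $F_{QNam}(\tilde P)=F_{Nam}(P)$ for any $P\in\tilde P$ (equivalent namings evaluate to the same point, so this is well defined). *)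

(* Defs.v *)
From HB Require Import structures.
From mathcomp Require Import all_boot all_order all_algebra.
From mathcomp Require Import interval_inference.
From mathcomp Require Import all_classical all_reals all_analysis.

Set Implicit Arguments.
Unset Strict Implicit.
Unset Printing Implicit Defensive.

Import Order.TTheory GRing.Theory Num.Theory.
Import numFieldNormedType.Exports.

Local Open Scope classical_set_scope.
Local Open Scope ring_scope.

Definition homeomorphism (X Y : topologicalType) (f : X -> Y) : Prop :=
  continuous f /\
  exists g : Y -> X, [/\ cancel f g, cancel g f & continuous g].

Definition convex_hull (R : realType) (E : lmodType R) (A : set E) : set E :=
  smallest (@convex_set R E) A.

Lemma convex_hull_sum (R : realType) (E : lmodType R) (A : set E) (n : nat)
    (c : 'I_n -> R) (x : 'I_n -> E) :
  (forall j, 0 <= c j) -> \sum_j c j = 1 -> (forall j, A (x j)) ->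
  convex_hull A (\sum_j c j *: x j).
Proof.
move=> c0 c1 Ax B [cvxB AB].
have {AB}Bx j : B (x j) by exact: AB.
elim: n => [|n IH] in c x c0 c1 {Ax} Bx *.
  by move: c1; rewrite big_ord0 => /esym/eqP; rewrite oner_eq0.
have le1 : c ord_max <= 1.
  by rewrite -c1 big_ord_recr/= lerDr sumr_ge0.
have sumE : \sum_(i < n) c (widen_ord (leqnSn n) i) = 1 - c ord_max.
  by rewrite -c1 big_ord_recr/= addrK.
rewrite big_ord_recr/=.
have [cn1|cn1] := eqVneq (c ord_max) 1.
  rewrite cn1 scale1r big1 ?add0r// => i _.
  have /psumr_eq0P -> // : \sum_(i < n) c (widen_ord (leqnSn n) i) = 0.
    by rewrite sumE cn1 subrr.
  by rewrite scale0r.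
have d_gt0 : 0 < 1 - c ord_max by rewrite subr_gt0 lt_neqAle cn1.
pose y := \sum_(i < n) (c (widen_ord (leqnSn n) i) / (1 - c ord_max)) *:
  x (widen_ord (leqnSn n) i).
have By : B y.
  apply: IH => // [j|]; first by rewrite divr_ge0// ltW.
  by rewrite -mulr_suml sumE divff// gt_eqF.
have := @cvxB (x ord_max) y (Itv01 (c0 ord_max) le1).
rewrite !inE => /(_ (Bx _) By); congr (B _).
rewrite [LHS]addrC; congr (_ + _); rewrite /y scaler_sumr; apply: eq_bigr => i _.
by rewrite scalerA mulrC divfK// gt_eqF.
Qed.

Definition moment_curve (R : realType) (N : nat) (t : R) : 'rV[R]_N :=
  \row_(i < N) t ^+ i.+1.

Definition conv_curve (R : realType) (N : nat) (tmin tmax : R) :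
    set 'rV[R]_N :=
  convex_hull [set moment_curve N t | t in `[tmin, tmax]].
Arguments conv_curve {R} N tmin tmax.

(* A point of R^(2M) is read as (c_1, ..., c_M, t_1, ..., t_M), indexed from 0. *)
Definition coefficient (R : realType) (M : nat) (P : 'rV[R]_(M + M))
  (j : 'I_M) : R := P 0 (lshift M j).

Definition parameter (R : realType) (M : nat) (P : 'rV[R]_(M + M))
  (j : 'I_M) : R := P 0 (rshift M j).

(* M > 0 is forced by the coefficients having sum 1. *)
Definition naming (R : realType) (tmin tmax : R) (M : nat)
    (P : 'rV[R]_(M + M)) : Prop :=
  [/\ forall j, 0 <= coefficient P j,
      \sum_j coefficient P j = 1,
      forall i j : 'I_M, (i <= j)%N -> parameter P i <= parameter P j
    & forall j, tmin <= parameter P j <= tmax].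

(* Integer and half-integer sizes M' are encoded by k = 2M': an M'-naming has
   uphalf k terms, i.e. M' of them for k even and M' + 1/2 for k odd, and in the
   latter case its first parameter is tmin. *)
Definition half_naming (R : realType) (tmin tmax : R) (k : nat)
    (P : 'rV[R]_(uphalf k + uphalf k)) : Prop :=
  naming tmin tmax P /\
  (odd k -> forall j : 'I_(uphalf k), j = 0%N :> nat -> parameter P j = tmin).

(* M' - (N+1)/2 is an integer iff 2M' and N+1 are congruent modulo 2. *)
Definition correct_parity (N k : nat) : Prop := (k = N.+1 %[mod 2])%N.

Record cp_naming (R : realType) (N : nat) (tmin tmax : R) := CPNaming {
  cp_size : nat;
  cp_vec : 'rV[R]_(uphalf cp_size + uphalf cp_size);
  cp_size_parity : correct_parity N cp_size;
  cp_vecP : half_naming tmin tmax cp_vec }.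

Definition vec_terms (R : realType) (M : nat) (P : 'rV[R]_(M + M)) :
    seq (R * R) :=
  [seq (coefficient P j, parameter P j) | j <- enum 'I_M].

Definition terms (R : realType) (N : nat) (tmin tmax : R)
    (P : cp_naming N tmin tmax) : seq (R * R) := vec_terms (cp_vec P).

Definition zero_addition (R : realType) (s s' : seq (R * R)) : Prop :=
  exists (s1 s2 : seq (R * R)) (t : R),
    s = s1 ++ s2 /\ s' = s1 ++ (0, t) :: s2.

Definition equal_split (R : realType) (s s' : seq (R * R)) : Prop :=
  exists (s1 s2 : seq (R * R)) (c c' c'' t : R),
    [/\ 0 <= c', 0 <= c'', c' + c'' = c, s = s1 ++ (c, t) :: s2
      & s' = s1 ++ (c', t) :: (c'', t) :: s2].

(* That zero-addition keeps the parameters sorted is part of both P and Q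
   being namings. *)
Definition directly_equivalent (R : realType) (N : nat) (tmin tmax : R)
    (P Q : cp_naming N tmin tmax) : Prop :=
  [\/ zero_addition (terms P) (terms Q), zero_addition (terms Q) (terms P),
      equal_split (terms P) (terms Q) | equal_split (terms Q) (terms P)].

Definition equivalent (R : realType) (N : nat) (tmin tmax : R)
    (P Q : cp_naming N tmin tmax) : Prop :=
  exists s : seq (cp_naming N tmin tmax),
    path (fun A B => `[< directly_equivalent A B >]) P s /\ last P s = Q.

Lemma equivalent_refl (R : realType) (N : nat) (tmin tmax : R)
  (P : cp_naming N tmin tmax) : equivalent P P.
Proof. by exists [::]. Qed.

Lemma equivalent_trans (R : realType) (N : nat) (tmin tmax : R)
  (P Q S : cp_naming N tmin tmax) :
  equivalent P Q -> equivalent Q S -> equivalent P S.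
Proof.
move=> [s [Ps <-]] [s' [Qs' <-]]; exists (s ++ s').
by rewrite cat_path Ps Qs' last_cat.
Qed.

Lemma directly_equivalent_sym (R : realType) (N : nat) (tmin tmax : R)
  (P Q : cp_naming N tmin tmax) :
  directly_equivalent P Q -> directly_equivalent Q P.
Proof. by case=> ?; [apply: Or42|apply: Or41|apply: Or44|apply: Or43]. Qed.

Lemma equivalent_sym (R : realType) (N : nat) (tmin tmax : R)
  (P Q : cp_naming N tmin tmax) : equivalent P Q -> equivalent Q P.
Proof.
move=> [s [Ps <-]] {Q}; elim: s P Ps => [|Q s IH] P /=.
  by move=> _; exact: equivalent_refl.
move=> /andP[/asboolP PQ /IH]; move/equivalent_trans; apply.
exists [:: P]; rewrite /= andbT; split=> //.
exact/asboolP/directly_equivalent_sym.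
Qed.

(* uphalf N.+1 is (N+1)/2 for N odd and (N+2)/2 for N even. *)
Definition Nam (R : realType) (N : nat) (tmin tmax : R) :
    set 'rV[R]_(uphalf N.+1 + uphalf N.+1) :=
  [set P | half_naming tmin tmax P].
Arguments Nam {R} N tmin tmax.

Definition cp_of_Nam (R : realType) (N : nat) (tmin tmax : R)
    (P : Nam N tmin tmax) : cp_naming N tmin tmax :=
  @CPNaming R N tmin tmax N.+1 (val P) erefl (set_valP P).

Definition Nam_rel (R : realType) (N : nat) (tmin tmax : R) :
    rel (Nam N tmin tmax) :=
  fun P Q => `[< equivalent (cp_of_Nam P) (cp_of_Nam Q) >].

Lemma Nam_rel_refl (R : realType) (N : nat) (tmin tmax : R) :
  reflexive (@Nam_rel R N tmin tmax).
Proof. by move=> P; apply/asboolP; exact: equivalent_refl. Qed.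

Lemma Nam_rel_sym (R : realType) (N : nat) (tmin tmax : R) :
  symmetric (@Nam_rel R N tmin tmax).
Proof. by move=> P Q; apply/asboolP/asboolP; exact: equivalent_sym. Qed.

Lemma Nam_rel_trans (R : realType) (N : nat) (tmin tmax : R) :
  transitive (@Nam_rel R N tmin tmax).
Proof.
move=> Q P S /asboolP PQ /asboolP QS; apply/asboolP.
exact: equivalent_trans PQ QS.
Qed.

Canonical Nam_equiv (R : realType) (N : nat) (tmin tmax : R) :=
  EquivRel (@Nam_rel R N tmin tmax) (@Nam_rel_refl R N tmin tmax)
    (@Nam_rel_sym R N tmin tmax) (@Nam_rel_trans R N tmin tmax).

Definition QNam (R : realType) (N : nat) (tmin tmax : R) : topologicalType :=
  quotient_topology {eq_quot (@Nam_rel R N tmin tmax)}%qT.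

Definition eval_naming (R : realType) (N M : nat) (P : 'rV[R]_(M + M)) :
    'rV[R]_N :=
  \sum_j coefficient P j *: moment_curve N (parameter P j).

Lemma eval_naming_conv (R : realType) (N : nat) (tmin tmax : R)
  (P : Nam N tmin tmax) : conv_curve N tmin tmax (eval_naming N (val P)).
Proof.
have [[c0 c1 _ tP] _] := set_valP P.
apply: convex_hull_sum => // j; exists (parameter (val P) j) => //=.
by rewrite in_itv/=; exact: tP.
Qed.

Definition FNam (R : realType) (N : nat) (tmin tmax : R)
    (P : Nam N tmin tmax) : conv_curve N tmin tmax :=
  exist _ (eval_naming N (val P)) (mem_set (eval_naming_conv P)).

(* Independent of the representative by FQNam_pi below. *)
Definition FQNam (R : realType) (N : nat) (tmin tmax : R)
    (P : QNam N tmin tmax) : conv_curve N tmin tmax := FNam (repr P).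

Lemma eval_vec_terms (R : realType) (N M : nat) (P : 'rV[R]_(M + M)) :
  eval_naming N P = \sum_(ct <- vec_terms P) ct.1 *: moment_curve N ct.2.
Proof. by rewrite big_map big_enum. Qed.

Lemma eval_equivalent (R : realType) (N : nat) (tmin tmax : R)
  (P Q : cp_naming N tmin tmax) : equivalent P Q ->
  eval_naming N (cp_vec P) = eval_naming N (cp_vec Q).
Proof.
move=> [s [Ps <-]] {Q}; elim: s P Ps => [|Q s IH] P //=.
move=> /andP[/asboolP PQ /IH <-] {IH}; rewrite !eval_vec_terms.
rewrite -/(terms P) -/(terms Q).
have zE (u v : seq (R * R)) : zero_addition u v ->
    \sum_(ct <- u) ct.1 *: moment_curve N ct.2 =
    \sum_(ct <- v) ct.1 *: moment_curve N ct.2.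
  by move=> [s1 [s2 [t [-> ->]]]]; rewrite !big_cat big_cons/= scale0r add0r.
have sE (u v : seq (R * R)) : equal_split u v ->
    \sum_(ct <- u) ct.1 *: moment_curve N ct.2 =
    \sum_(ct <- v) ct.1 *: moment_curve N ct.2.
  move=> [s1 [s2 [c [c' [c'' [t [_ _ <- -> ->]]]]]]].
  by rewrite !big_cat !big_cons/= scalerDl -!addrA.
by case: PQ => [/zE|/zE|/sE|/sE].
Qed.

Lemma FQNam_pi (R : realType) (N : nat) (tmin tmax : R)
  (P : Nam N tmin tmax) : FQNam (\pi_(QNam N tmin tmax) P)%qT = FNam P.
Proof.
apply: val_inj; rewrite /FQNam /=.
have : (repr (\pi_(QNam N tmin tmax) P) = P
    %[mod {eq_quot (@Nam_rel R N tmin tmax)}])%qT by rewrite reprK.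
by move=> /eqmodP/asboolP/eval_equivalent.
Qed.

(* Main.v *)
From HB Require Import structures.
Require Import Defs.
From mathcomp Require Import polyrcf.
From mathcomp Require Import all_boot all_order all_algebra.
From mathcomp Require Import interval_inference.
From mathcomp Require Import all_classical all_reals all_analysis.
From mathcomp Require Import ring zify.

Set Implicit Arguments.
Unset Strict Implicit.
Unset Printing Implicit Defensive.

Import Order.TTheory GRing.Theory Num.Theory.
Import numFieldNormedType.Exports.
Local Open Scope ring_scope.

(* The map is a continuous bijection from a compact space to a Hausdorff space.

   Injectivity: adding zero terms and merging repeated parameters turns two
   namings of a point into namings with the same strictly increasing list of
   parameters, without changing their classes. There are at most [N + 1] such
   parameters (for [N] even, both namings contain [tmin]), and Lagrange
   interpolation recovers the coefficients from the moments of order at most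
   [N].

   Surjectivity: a point of the convex hull is the moment vector of a finitely
   supported measure. Gauss quadrature for [N] odd, and Gauss-Radau quadrature
   with prescribed node [tmin] for [N] even, give a measure with the same
   moments up to [N] and few enough nodes. *)

(** * Finitely supported measures and Lagrange interpolation *)

(** A pair [(c, t)] is a mass [c] at the node [t]; nodes may repeat and masses may vanish, as in a
    naming. *)
Definition discrete_integral (F : fieldType) (s : seq (F * F)) (f : {poly F}) : F :=
  \sum_(ct <- s) ct.1 * f.[ct.2].

Fact discrete_integral_is_scalar (F : fieldType) (s : seq (F * F)) :
  scalar (discrete_integral s).
Proof.
move=> k f g; rewrite /discrete_integral mulr_sumr -big_split/=.
by apply: eq_bigr => ct _; rewrite hornerD hornerZ mulrDr mulrCA.
Qed.

HB.instance Definition _ (F : fieldType) (s : seq (F * F)) :=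
  GRing.isLinear.Build F {poly F} F *%R (discrete_integral s)
    (discrete_integral_is_scalar s).

(** Exchanging the two sums sends each mass to its own node. Nodes of [zs] that carry no mass
    receive weight 0. *)
Lemma discrete_integral_gather (F : fieldType) (s : seq (F * F)) (zs : seq F) :
  uniq zs -> (forall ct, ct \in s -> ct.1 != 0 -> ct.2 \in zs) ->
  discrete_integral [seq (\sum_(ct <- s | ct.2 == z) ct.1, z) | z <- zs] =1
  discrete_integral s.
Proof.
move=> uzs szs f; rewrite /discrete_integral big_map/=.
under eq_bigr do rewrite mulr_suml big_mkcond.
rewrite exchange_big/=; apply: eq_big_seq => ct /szs.
have [->|_ /(_ isT) ctz] := eqVneq ct.1 0.
  by move=> _; rewrite mul0r; apply: big1 => z _; rewrite mul0r if_same.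
rewrite (bigD1_seq ct.2)//= eqxx big1 ?addr0// => z /negPf zt.
by rewrite eq_sym zt.
Qed.

Definition lagrange_poly (F : fieldType) (zs : seq F) (z : F) : {poly F} :=
  (\prod_(y <- rem z zs) (z - y))^-1 *: \prod_(y <- rem z zs) ('X - y%:P).

Lemma size_lagrange_poly (F : fieldType) (zs : seq F) (z : F) :
  z \in zs -> (size (lagrange_poly zs z) <= size zs)%N.
Proof.
move=> zzs; apply: leq_trans (size_scale_leq _ _) _.
by rewrite size_prod_XsubC size_rem// prednK//; case: zs zzs.
Qed.

Lemma lagrange_poly_horner (F : fieldType) (zs : seq F) (z y : F) :
  uniq zs -> y \in zs -> (lagrange_poly zs z).[y] = (y == z)%:R.
Proof.
move=> uzs yzs; rewrite hornerZ horner_prod.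
under [X in _ * X]eq_bigr do rewrite hornerXsubC.
have [->|yz] := eqVneq y z.
  rewrite mulVf// prodf_seq_neq0; apply/allP => x.
  by rewrite mem_rem_uniq// inE subr_eq0 eq_sym => /andP[].
rewrite [X in _ * X](big_rem y) ?mem_rem_uniq ?inE ?yz//.
by rewrite /= subrr mul0r mulr0.
Qed.

(** The difference of the two sides vanishes at all nodes, and its degree is less than their
    number. *)
Lemma lagrange_interpolation (F : fieldType) (zs : seq F) (f : {poly F}) :
  uniq zs -> (size f <= size zs)%N ->
  f = \sum_(z <- zs) f.[z] *: lagrange_poly zs z.
Proof.
move=> uzs szf; apply/eqP; rewrite -subr_eq0; apply/eqP.
apply: (@roots_geq_poly_eq0 _ _ zs) => //.
- apply/allP => y yzs; rewrite rootE hornerD hornerN horner_sum.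
  rewrite (bigD1_seq y)//= hornerZ lagrange_poly_horner// eqxx mulr1.
  rewrite big1 ?addr0 ?subrr// => z zy.
  by rewrite hornerZ lagrange_poly_horner// eq_sym (negPf zy) mulr0.
- apply: leq_trans (size_polyD _ _) _; rewrite geq_max szf size_polyN/=.
  rewrite big_seq; elim/big_rec: _ => [|z p zzs szp]; first by rewrite size_poly0.
  apply: leq_trans (size_polyD _ _) _; rewrite geq_max szp andbT.
  exact: leq_trans (size_scale_leq _ _) (size_lagrange_poly _).
Qed.

Lemma discrete_integral_lagrange (F : fieldType) (s : seq (F * F)) (i : nat) :
  uniq (unzip2 s) -> (i < size s)%N ->
  discrete_integral s (lagrange_poly (unzip2 s) (nth 0 (unzip2 s) i)) =
  nth 0 (unzip1 s) i.
Proof.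
move=> us lis; rewrite /discrete_integral (big_nth (0, 0)) big_mkord.
have nth2 j : (j < size s)%N -> (nth (0, 0) s j).2 = nth 0 (unzip2 s) j.
  by move=> js; rewrite (nth_map (0, 0)).
rewrite (bigD1 (Ordinal lis))//= nth2// lagrange_poly_horner ?mem_nth ?size_map//.
rewrite eqxx mulr1 big1 ?addr0 ?(nth_map (0, 0))// => j ji.
rewrite !nth2// lagrange_poly_horner ?mem_nth ?size_map//.
by rewrite nth_uniq ?size_map// (negPf ji : (j == i :> nat) = false) mulr0.
Qed.

(** Integrating the Lagrange polynomial of a node returns the weight at that node, and its size is
    at most the number of nodes. *)
Lemma discrete_integral_inj (F : fieldType) (s s' : seq (F * F)) :
  uniq (unzip2 s) -> unzip2 s = unzip2 s' ->
  (forall f : {poly F}, (size f <= size s)%N ->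
    discrete_integral s f = discrete_integral s' f) -> s = s'.
Proof.
move=> us ss' ints; rewrite -[s]zip_unzip -[s']zip_unzip ss'; congr zip.
have sz : size s = size s'.
  by rewrite -(size_map snd) -[RHS](size_map snd) -/(unzip2 s) ss'.
apply: (@eq_from_nth _ 0) => [|i]; rewrite size_map ?[in RHS]size_map// => lis.
rewrite -(discrete_integral_lagrange us lis).
rewrite -(@discrete_integral_lagrange _ s') -?ss' -?sz// ints//.
apply: leq_trans (size_lagrange_poly _) _; rewrite ?size_map//.
by rewrite mem_nth// size_map.
Qed.

(** * Orthogonal polynomials and signs of polynomials on an interval *)

Lemma rVpolyE (R : nzRingType) (d : nat) (v : 'rV[R]_d) :
  rVpoly v = \sum_(i < d) v 0 i *: 'X^i.
Proof. by rewrite /rVpoly poly_def; apply: eq_bigr => i _; rewrite valK. Qed.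

(** Orthogonality to the monomials of degree less than [n] is [n] linear equations in [n + 1]
    coefficients. As [L] may be degenerate, [p] may have degree less than [n]. *)
Lemma orthogonal_poly (F : fieldType) (L : {scalar {poly F}}) (w : {poly F})
    (n : nat) :
  exists p : {poly F}, [/\ p != 0, (size p <= n.+1)%N &
    forall q : {poly F}, (size q <= n)%N -> L (w * p * q) = 0].
Proof.
pose A := \matrix_(i < n.+1, k < n) L (w * 'X^i * 'X^k).
have /rowV0Pn[v /sub_kermxP vA v0] : kermx A != 0.
  by rewrite -mxrank_eq0 mxrank_ker subn_eq0 -ltnNge ltnS rank_leq_col.
exists (rVpoly v); split.
- by apply: contra_neq v0 => v0; apply: (can_inj rVpolyK); rewrite v0 linear0.
- exact: size_poly.
move=> q szq; rewrite -(poly_rV_K szq) !rVpolyE.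
rewrite mulr_sumr linear_sum big1//= => k _.
have vk0 : \sum_(i < n.+1) v 0 i * L (w * 'X^i * 'X^k) = 0.
  have := congr1 (fun u : 'rV__ => u 0 k) vA; rewrite !mxE => vAk.
  by rewrite -[RHS]vAk; apply: eq_bigr => i _; rewrite mxE.
rewrite -scalerAr linearZ/= mulr_sumr mulr_suml linear_sum/=.
rewrite [X in _ * X](_ : _ = 0) ?mulr0// -[RHS]vk0.
by apply: eq_bigr => i _; rewrite -scalerAr -scalerAl linearZ.
Qed.

(** [xs] lists the roots in [D] of odd multiplicity: when a root already in [xs] is met again, the
    pair moves into the square [h ^+ 2]. *)
Lemma factor_roots_in_interval (R : rcfType) (D : interval R) (p : {poly R}) :
  p != 0 -> exists (xs : seq R) (h g : {poly R}),
  [/\ uniq xs, {subset xs <= D}, p = \prod_(x <- xs) ('X - x%:P) * h ^+ 2 * g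
    & forall x, x \in D -> ~~ root g x].
Proof.
move: {2}(size p) (leqnn (size p)) => k; elim: k p => [|k IH] p szp p0.
  by move: szp; rewrite leqn0 size_poly_eq0 (negPf p0).
have [[x xD px]|nr] := pselect (exists2 x, x \in D & root p x); last first.
  exists [::], 1, p; split => //; first by rewrite big_nil expr1n !mul1r.
  by move=> x xD; apply/negP => px; apply: nr; exists x.
have /factor_theorem[p' pE] := px.
have p'0 : p' != 0 by apply: contra_neq p0 => p'0; rewrite pE p'0 mul0r.
have szp' : (size p' <= k)%N.
  by move: szp; rewrite pE size_mul ?polyXsubC_eq0// size_XsubC addn2.
have [xs [h [g [uxs xsD p'E gD]]]] := IH p' szp' p'0.
have [xxs|xxs] := boolP (x \in xs).
  exists (rem x xs), (('X - x%:P) * h), g; split => //.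
  - exact: rem_uniq.
  - by move=> y /mem_rem; exact: xsD.
  by rewrite pE p'E (big_rem x)//=; ring.
exists (x :: xs), h, g; split => //=; first by rewrite xxs.
- by move=> y; rewrite inE => /predU1P[->//|/xsD].
by rewrite pE p'E big_cons; ring.
Qed.

(** A change of sign would give a root between [x] and [y], and that root lies in [D]. *)
Lemma rootless_interval_sign (R : rcfType) (D : interval R) (g : {poly R}) :
  (forall x, x \in D -> ~~ root g x) ->
  {in D &, forall x y, 0 < g.[x] * g.[y]}.
Proof.
move=> gD x y; wlog xy : x y / x <= y => [H xD yD|xD yD].
  have [/H|/ltW/H] := leP x y; first exact.
  by rewrite mulrC; exact.
rewrite ltNge le_eqVlt mulf_eq0 -!rootE (negPf (gD _ xD)) (negPf (gD _ yD))/=.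
apply/negP => /(poly_ivtoo xy)[z zxy]; apply/negP/gD.
move: xD yD zxy; case: D {gD} => l u; rewrite !itv_boundlr.
move=> /andP[lx _] /andP[_ yu] /andP[xz zy]; apply/andP; split.
  by apply: le_trans lx (le_trans _ xz); rewrite bnd_simp.
by apply: le_trans yu; apply: le_trans zy _; rewrite bnd_simp.
Qed.

(** * Gauss and Gauss-Radau quadrature *)

Section Quadrature.
Context (R : rcfType) (a b : R) (N : nat) (s : seq (R * R)).
Hypothesis ab : a <= b.
Hypothesis s_ge0 : forall ct, ct \in s -> 0 <= ct.1.
Hypothesis s_ab : forall ct, ct \in s -> a <= ct.2 <= b.

(* [e] nodes are prescribed, equal to [a], and [n] are free; they are sought in
   [D], where the weight [w] is positive. *)
Let e : nat := ~~ odd N.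
Let n := (N.+1)./2.
Let D := Interval (BSide (odd N) a) (BRight b).
Let w : {poly R} := \prod_(z <- nseq e a) ('X - z%:P).

Let szN : (N.+1 = e + n.*2)%N.
Proof. by rewrite /e /n -[LHS]odd_double_half. Qed.

Let D_ab x : x \in D -> a <= x <= b.
Proof.
rewrite /D itv_boundlr => /andP[ax xb]; apply/andP; split; last first.
  by move: xb; rewrite bnd_simp.
by move: ax; case: odd; rewrite bnd_simp// => /ltW.
Qed.

Let aD : e = 1%N -> a \notin D.
Proof. by rewrite /e /D in_itv/=; case: odd => //=; rewrite ltxx. Qed.

(** For [N] even, [D] is open at [a], and the point left out is the prescribed node. *)
Let ab_D x : a <= x <= b -> (x \in D) || (x \in nseq e a).
Proof.
rewrite /D /e in_itv/=; case: odd => /=; rewrite ?orbF// => /andP[ax ->].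
by rewrite inE andbT lt_neqAle ax andbT eq_sym orNb.
Qed.

Let w_gt0 x : x \in D -> 0 < w.[x].
Proof.
rewrite /w /D /e in_itv/=; case: odd; rewrite ?big_nil ?big_seq1.
  by rewrite hornerC ltr01.
by rewrite hornerXsubC subr_gt0 => /andP[].
Qed.

Let w_eq0 x : x \in nseq e a -> w.[x] = 0.
Proof.
rewrite /w /e; case: odd => //; rewrite big_seq1 inE => /eqP->.
by rewrite hornerXsubC subrr.
Qed.

Let nodes_uniq (ys : seq R) :
  uniq ys -> {subset ys <= D} -> uniq (nseq e a ++ ys).
Proof.
move=> uys ysD; rewrite cat_uniq uys andbT.
rewrite (_ : uniq (nseq e a)); last by rewrite /e; case: odd.
apply/hasPn => y /ysD; apply: contraL.
by rewrite mem_nseq => /andP[e1 /eqP->]; apply: aD; move: e1; rewrite /e; case: odd.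
Qed.

Let quadrature_spec (zs : seq R) (s' : seq (R * R)) :=
  [/\ unzip2 s' = zs, forall ct, ct \in s' -> 0 <= ct.1
    & forall f : {poly R}, (size f <= N.+1)%N ->
        discrete_integral s f = discrete_integral s' f].

(* Here [p * q] has constant sign on [D], where [q] is the product of the
   ['X - x], so that orthogonality forces the support of [s] into the roots of
   [w * p] and [s] itself is the quadrature. *)
Let few_roots_quadrature (xs : seq R) (h g : {poly R}) :
  let p := \prod_(x <- xs) ('X - x%:P) * h ^+ 2 * g in
  (size xs < n)%N -> (size p <= n.+1)%N -> p != 0 ->
  (forall x, x \in D -> ~~ root g x) ->
  (forall q : {poly R}, (size q <= n)%N -> discrete_integral s (w * p * q) = 0) ->
  exists2 ys : seq R, (size ys <= n)%N & {subset ys <= D} /\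
    exists s', quadrature_spec (nseq e a ++ ys) s'.
Proof.
move=> p xsn szp p0 gD pq0.
pose q := \prod_(x <- xs) ('X - x%:P).
have [u uE] : {u | u = q * h} by exists (q * h).
(* Since [xs] has fewer than [n] elements, [q] is an admissible test polynomial, and
   [p * q = u ^+ 2 * g]. *)
have wu0 : discrete_integral s (w * u ^+ 2 * g) = 0.
  rewrite -(pq0 q) ?size_prod_XsubC//; congr discrete_integral.
  by rewrite uE /p -/q; ring.
(* Multiplied by the constant [g.[ct.2]], every term of the vanishing sum [wu0] is nonnegative: [g]
   keeps its sign on [D], and [w] vanishes at the prescribed node. So each term is zero, and the
   term of [ct] itself forces [u], hence [p], to vanish at [ct.2]. *)
have root_s ct : ct \in s -> ct.1 != 0 -> ct.2 \in D -> root p ct.2.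
  move=> cts ct0 ctD.
  have term_ge0 ct' : ct' \in s ->
      0 <= ct'.1 * (w * u ^+ 2 * g).[ct'.2] * g.[ct.2].
    move=> ct's; rewrite 2!hornerM horner_exp.
    rewrite (_ : _ * _ = ct'.1 * (w.[ct'.2] * (u.[ct'.2] ^+ 2 *
      (g.[ct'.2] * g.[ct.2])))); last by ring.
    rewrite mulr_ge0 ?s_ge0//.
    case/orP: (ab_D (s_ab ct's)) => [ct'D|/w_eq0->]; last by rewrite mul0r.
    apply: mulr_ge0; first exact/ltW/w_gt0.
    apply: mulr_ge0; first exact: sqr_ge0.
    exact/ltW/(rootless_interval_sign gD).
  have : \sum_(ct' <- s) ct'.1 * (w * u ^+ 2 * g).[ct'.2] * g.[ct.2] == 0.
    by rewrite -mulr_suml (wu0 : \sum_(_ <- _) _ = 0) mul0r.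
  rewrite big_seq psumr_eq0// => /allP/(_ _ cts); rewrite cts/=.
  rewrite 2!hornerM horner_exp !mulf_eq0 (negPf ct0) (gt_eqF (w_gt0 ctD)).
  rewrite -!rootE (negPf (gD _ ctD)) !orbF/= orbb uE.
  rewrite rootM /p -/q => /orP[]/rootP r0; apply/rootP;
    by rewrite !hornerM r0 ?(mul0r, mulr0).
(* These are distinct roots of [p], whose size is at most [n + 1], so there are at most [n] of
   them. *)
pose ys := undup [seq ct.2 | ct <- s & (ct.1 != 0) && (ct.2 \in D)].
have ysP y : y \in ys -> (y \in D) && root p y.
  rewrite mem_undup => /mapP[ct]; rewrite mem_filter => /andP[/andP[c0 cD] cts] ->.
  by rewrite cD root_s.
exists ys.
  rewrite -ltnS; apply: leq_trans szp; apply: max_poly_roots => //.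
    by apply/allP => y /ysP/andP[].
  exact: undup_uniq.
split; first by move=> y /ysP/andP[].
exists [seq (\sum_(ct <- s | ct.2 == z) ct.1, z) | z <- nseq e a ++ ys].
split; last first.
- move=> f _; symmetry; apply: discrete_integral_gather => [|ct cts ct0].
    by rewrite nodes_uniq ?undup_uniq// => y /ysP/andP[].
  rewrite mem_cat orbC; case/orP: (ab_D (s_ab cts)) => [ctD|->]; last by rewrite orbT.
  by rewrite mem_undup (map_f snd)// mem_filter ct0 ctD.
- move=> _ /mapP[z _ ->]/=; rewrite big_seq_cond sumr_ge0// => ct /andP[cts _].
  exact: s_ge0.
by rewrite /unzip2 -map_comp map_id.
Qed.

(** Divide [f] by the node polynomial [P]. The quotient has size at most [N + 1 - (e + n) = n], so
    its product with [P] integrates to 0; the remainder is recovered from the values of [f] at the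
    nodes. *)
Let full_roots_quadrature (ys : seq R) :
  uniq ys -> {subset ys <= D} -> size ys = n ->
  (forall q : {poly R}, (size q <= n)%N ->
    discrete_integral s (w * \prod_(y <- ys) ('X - y%:P) * q) = 0) ->
  exists s', quadrature_spec (nseq e a ++ ys) s'.
Proof.
move=> uys ysD ysn pq0; set zs := _ ++ _.
pose P := \prod_(z <- zs) ('X - z%:P).
have szs : size zs = (e + n)%N by rewrite size_cat size_nseq ysn.
have uzs : uniq zs by exact: nodes_uniq.
have PE : P = w * \prod_(y <- ys) ('X - y%:P) by rewrite /P big_cat.
have Proot z : z \in zs -> P.[z] = 0.
  by move=> zzs; apply/eqP; rewrite -rootE root_prod_XsubC.
have szP : size P = (size zs).+1 by rewrite size_prod_XsubC.
have P0 : P != 0 by rewrite -size_poly_eq0 szP.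
have exact_f (f : {poly R}) : (size f <= N.+1)%N -> discrete_integral s f =
    \sum_(z <- zs) f.[z] * discrete_integral s (lagrange_poly zs z).
  move=> szf; rewrite [in LHS](divp_eq f P) linearD/= mulrC PE pq0 -?PE ?add0r; last first.
    by rewrite size_divp// szP szs/= leq_subLR -addnA addnn -szN.
  rewrite [f %% P](lagrange_interpolation uzs) ?linear_sum/=; last first.
    by rewrite -ltnS -szP ltn_modp.
  apply: eq_big_seq => z zzs; rewrite linearZ/=; congr (_ * _).
  by rewrite [in RHS](divp_eq f P) hornerD hornerM Proot// mulr0 add0r.
exists [seq (discrete_integral s (lagrange_poly zs z), z) | z <- zs]; split.
- by rewrite /unzip2 -map_comp map_id.
- move=> _ /mapP[z zzs ->]/=; set l := lagrange_poly zs z.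
  have szl : (size (l ^+ 2) <= N.+1)%N.
    have szl : (size l <= size zs)%N by exact: size_lagrange_poly.
    rewrite expr2; apply: leq_trans (size_polyMleq _ _) _.
    have e1 : (e <= 1)%N by rewrite /e; case: odd.
    by rewrite szN; move: szl; rewrite szs; lia.
  (* [l] and [l ^+ 2] agree at the nodes, so the weight is the integral of a
     square; the quadrature applies to [l ^+ 2] because its degree is at most
     [2 (e + n - 1) <= N]. *)
  suff <- : discrete_integral s (l ^+ 2) = discrete_integral s l.
    rewrite /discrete_integral big_seq sumr_ge0// => ct cts.
    by rewrite mulr_ge0 ?s_ge0// hornerM -expr2 sqr_ge0.
  rewrite exact_f// (bigD1_seq z)//= hornerM lagrange_poly_horner// eqxx !mul1r.
  rewrite big_seq_cond big1 ?addr0// => y /andP[yzs /negPf yz].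
  by rewrite hornerM lagrange_poly_horner// yz !mul0r.
move=> f szf; rewrite exact_f// /discrete_integral big_map/=.
by under eq_bigr do rewrite mulrC.
Qed.

(** The case split is on the number of odd-multiplicity roots in [D] of an orthogonal polynomial
    [p]: with fewer than [n], the measure already has few nodes; otherwise these roots are the free
    nodes. *)
Lemma gauss_radau_quadrature : exists s' : seq (R * R),
  [/\ (size s' <= uphalf N.+1)%N,
      forall ct, ct \in s' -> (0 <= ct.1) && (a <= ct.2 <= b),
      ~~ odd N -> a \in unzip2 s'
    & forall f : {poly R}, (size f <= N.+1)%N ->
        discrete_integral s f = discrete_integral s' f].
Proof.
have [ys ysn [ysD [s' [s'E s'0 s'f]]]] : exists2 ys : seq R, (size ys <= n)%N &
    {subset ys <= D} /\ exists s', quadrature_spec (nseq e a ++ ys) s'.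
  have [p [p0 szp pq0]] := orthogonal_poly (discrete_integral s) w n.
  have [xs [h [g [uxs xsD pE gD]]]] := factor_roots_in_interval D p0.
  have [xsn|nxs] := ltnP (size xs) n.
    by rewrite pE in p0 szp pq0; exact: few_roots_quadrature xsn szp p0 gD pq0.
  pose k := h ^+ 2 * g.
  have pk : p = \prod_(x <- xs) ('X - x%:P) * k by rewrite pE -mulrA.
  have k0 : k != 0 by apply: contra_neq p0 => k0; rewrite pk k0 mulr0.
  (* At least [n] linear factors in a polynomial of degree at most [n] leave only a constant
     cofactor [k]. *)
  have szpk : size p = (size xs + size k)%N.
    by rewrite pk size_monicM ?monic_prod_XsubC// size_prod_XsubC addSn.
  have szk : (0 < size k)%N by rewrite size_poly_gt0.
  have xsn : size xs = n by lia.
  have [c kE] : exists c, k = c%:P by exists (k`_0); apply: size1_polyC; lia.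
  have c0 : c != 0 by rewrite -polyC_eq0 -kE.
  exists xs; first by rewrite xsn.
  split => //; apply: full_roots_quadrature => // q szq.
  apply: (mulfI c0); rewrite mulr0 -(pq0 q szq) pk kE -linearZ.
  by congr discrete_integral; rewrite -mul_polyC; ring.
have s'2 ct : ct \in s' -> ct.2 \in nseq e a ++ ys.
  by rewrite -s'E; exact: map_f.
exists s'; split => //.
(* The bound is [e + n], that is [(N + 1) / 2] for [N] odd and [1 + N / 2] for [N] even. *)
- rewrite -(size_map snd) -/(unzip2 _) s'E size_cat size_nseq.
  have := szN; have := odd_double_half N.+1; rewrite uphalf_half /e/= -/n.
  by move: ysn; case: odd => /=; lia.
- move=> ct cts; rewrite s'0//=; have := s'2 _ cts.
  rewrite mem_cat mem_nseq => /orP[/andP[_ /eqP->]|/ysD/D_ab//].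
  by rewrite lexx ab.
- by rewrite s'E mem_cat mem_nseq eqxx andbT /e => ->.
Qed.
End Quadrature.

(** * Namings as lists of terms, and their equivalence *)

Section ValidTerms.
Context (R : realType) (N : nat) (a b : R).
Implicit Types (s : seq (R * R)) (P Q : cp_naming N a b).

(** For [N] even, the condition on the first parameter becomes membership of [a]. This is the same
    for a sorted list bounded below by [a], and is visibly preserved when terms are added or
    merged. *)
Definition valid_terms s : Prop :=
  [/\ forall ct, ct \in s -> (0 <= ct.1) && (a <= ct.2 <= b),
      \sum_(ct <- s) ct.1 = 1,
      sorted <=%R (unzip2 s)
    & ~~ odd N -> a \in unzip2 s].

Lemma size_vec_terms M (P : 'rV[R]_(M + M)) : size (vec_terms P) = M.
Proof. by rewrite size_map size_enum_ord. Qed.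

Lemma nth_vec_terms M (P : 'rV[R]_(M + M)) (j : 'I_M) :
  nth (0, 0) (vec_terms P) j = (coefficient P j, parameter P j).
Proof. by rewrite (nth_map j) ?size_enum_ord// nth_ord_enum. Qed.

Lemma valid_vec_terms k (P : 'rV[R]_(uphalf k + uphalf k)) :
  odd k = ~~ odd N -> half_naming a b P -> valid_terms (vec_terms P).
Proof.
move=> oddk [[c0 c1 tP abP] tP0]; split.
- by move=> ct /mapP[j _ ->]/=; rewrite c0 abP.
- by rewrite big_map big_enum.
- apply/(sortedP 0) => i; rewrite size_map size_vec_terms => ik.
  rewrite !(nth_map (0, 0)) ?size_vec_terms ?(ltnW ik)//.
  by rewrite (nth_vec_terms P (Ordinal ik)) (nth_vec_terms P (Ordinal (ltnW ik))) tP/=.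
rewrite -oddk => kodd; have k0 : (0 < uphalf k)%N by case: (k) kodd.
rewrite -(tP0 kodd (Ordinal k0))//; apply/mapP.
exists (coefficient P (Ordinal k0), parameter P (Ordinal k0)) => //.
by apply/mapP; exists (Ordinal k0); rewrite ?mem_enum.
Qed.

Lemma valid_cp_terms P : valid_terms (terms P).
Proof.
apply: valid_vec_terms (cp_vecP P); have := cp_size_parity P.
by rewrite /correct_parity !modn2/=; case: odd; case: odd.
Qed.

Definition vec_of_terms M s : 'rV[R]_(M + M) :=
  row_mx (\row_(j < M) (nth (0, 0) s j).1) (\row_(j < M) (nth (0, 0) s j).2).

Lemma coefficient_vec_of_terms M s (j : 'I_M) :
  coefficient (vec_of_terms M s) j = (nth (0, 0) s j).1.
Proof. by rewrite /coefficient row_mxEl mxE. Qed.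

Lemma parameter_vec_of_terms M s (j : 'I_M) :
  parameter (vec_of_terms M s) j = (nth (0, 0) s j).2.
Proof. by rewrite /parameter row_mxEr mxE. Qed.

Lemma vec_of_termsK M s : size s = M -> vec_terms (vec_of_terms M s) = s.
Proof.
move=> sM; apply: (@eq_from_nth _ (0, 0)); rewrite size_vec_terms// => i iM.
rewrite (nth_vec_terms _ (Ordinal iM)).
by rewrite coefficient_vec_of_terms parameter_vec_of_terms -surjective_pairing.
Qed.

Lemma half_naming_vec_of_terms k s :
  odd k = ~~ odd N -> size s = uphalf k -> valid_terms s ->
  half_naming a b (vec_of_terms (uphalf k) s).
Proof.
move=> oddk sk [sP s1 ss sa].
have js (j : 'I_(uphalf k)) : nth (0, 0) s j \in s by rewrite mem_nth// sk.
have nth2 i : (i < uphalf k)%N -> (nth (0, 0) s i).2 = nth 0 (unzip2 s) i.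
  by move=> ik; rewrite (nth_map (0, 0)) ?sk.
split.
  split=> [j||i j ij|j]; rewrite ?parameter_vec_of_terms ?coefficient_vec_of_terms.
  - by have /andP[] := sP _ (js j).
  - rewrite -[RHS]s1 (big_nth (0, 0)) big_mkord sk.
    by apply: eq_bigr => j _; rewrite coefficient_vec_of_terms.
  - by rewrite !nth2// le_sorted_leq_nth// inE size_map sk.
  - by have /andP[] := sP _ (js j).
(* The first parameter is at least [a], and at most every parameter in the sorted list, among which
   is [a]. *)
move=> ko j j0; rewrite parameter_vec_of_terms; apply/eqP; rewrite eq_le.
have /andP[_ /andP[-> _]] := sP _ (js j); rewrite andbT nth2// j0.
have := sa; rewrite -oddk => /(_ ko) /(nthP 0)[i]; rewrite size_map => si <-.
apply: le_sorted_leq_nth; rewrite // inE size_map ?sk//.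
  by rewrite -[X in (X < _)%N]j0.
by rewrite -sk.
Qed.

Lemma exists_cp_naming s : valid_terms s -> exists P, terms P = s.
Proof.
move=> vs; pose k := ((size s).*2 - ~~ odd N)%N.
have s0 : (0 < size s)%N.
  by case: vs => _ + _ _; case: (s) => //; rewrite big_nil => /esym/eqP; rewrite oner_eq0.
have oddk : odd k = ~~ odd N.
  have sN : (~~ odd N <= (size s).*2)%N by case: odd => //=; lia.
  by rewrite /k oddB// odd_double addFb oddb.
have sk : size s = uphalf k.
  by rewrite uphalf_half oddk /k; case: odd => /=; lia.
have parity : correct_parity N k by rewrite /correct_parity !modn2 oddk.
exists (CPNaming parity (half_naming_vec_of_terms oddk sk vs)).
exact: vec_of_termsK.
Qed.

Lemma exists_Nam s : valid_terms s -> size s = uphalf N.+1 ->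
  exists P : Nam N a b, vec_terms (val P) = s.
Proof.
move=> vs sN.
have /mem_set h : Nam N a b (vec_of_terms (uphalf N.+1) s).
  exact: half_naming_vec_of_terms.
exists (exist _ (vec_of_terms (uphalf N.+1) s) h).
exact: vec_of_termsK.
Qed.

(** Carries equivalence over to lists, free of sizes and proofs. It holds vacuously for a list
    realised by no naming, so transitivity asks for a valid middle list. *)
Definition term_equiv s s' : Prop :=
  forall P Q, terms P = s -> terms Q = s' -> equivalent P Q.

Lemma directly_equivalent_equivalent P Q :
  directly_equivalent P Q -> equivalent P Q.
Proof. by move=> PQ; exists [:: Q]; rewrite /= andbT; split=> //; exact/asboolP. Qed.

Lemma term_equiv_trans s s' s'' : valid_terms s' ->
  term_equiv s s' -> term_equiv s' s'' -> term_equiv s s''.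
Proof.
move=> /exists_cp_naming[S Ss] ss' s's'' P Q Ps Qs.
exact: equivalent_trans (ss' _ _ Ps Ss) (s's'' _ _ Ss Qs).
Qed.

Lemma sorted_split s t : sorted <=%R (unzip2 s) -> exists s1 s2,
  [/\ s = s1 ++ s2, all (fun x => x <= t) (unzip2 s1)
    & all (fun x => t <= x) (unzip2 s2)].
Proof.
elim: s => [_|ct s IH]; first by exists [::], [::].
move=> /= cts; have [ctt|tct] := leP ct.2 t.
  have [s1 [s2 [-> s1t s2t]]] := IH (path_sorted cts).
  by exists (ct :: s1), s2; rewrite /= ctt.
exists [::], (ct :: s); split => //=; rewrite (ltW tct)/=.
move: cts; rewrite (path_sortedE le_trans) => /andP[+ _].
by apply: sub_all => x; exact/le_trans/ltW.
Qed.

(** The zero term goes between the parameters at most [t] and those at least [t]. *)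
Lemma zero_addition_exists s t : a <= t <= b -> valid_terms s -> exists s',
  [/\ zero_addition s s', valid_terms s' & unzip2 s' =i t :: unzip2 s].
Proof.
move=> tab [sP s1 ss sa]; have [u [v [suv ut tv]]] := sorted_split t ss.
have uvE : unzip2 (u ++ (0, t) :: v) =i t :: unzip2 s.
  by move=> x; rewrite suv /unzip2 !map_cat/= !(mem_cat, inE) orbCA.
exists (u ++ (0, t) :: v); split => //; first by exists u, v, t.
split.
- move=> ct; rewrite mem_cat inE orbCA -mem_cat -suv => /predU1P[->|/sP//].
  by rewrite lexx.
- by rewrite big_cat big_cons/= add0r -big_cat -suv.
- move: ss; rewrite suv /unzip2 !map_cat/=.
  rewrite !(sorted_pairwise le_trans) !pairwise_cat/= => /and3P[uv -> ->].
  rewrite tv andbT/= !allrel_consr ut uv.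
  by [].
- by move=> /sa; rewrite uvE inE orbC => ->.
Qed.

(* Namings with the same terms are distinct records of possibly distinct sizes,
   but they have a common zero-addition. *)
Lemma term_equiv_refl s : a <= b -> valid_terms s -> term_equiv s s.
Proof.
move=> ab vs P Q Ps Qs.
have aab : a <= a <= b by rewrite lexx.
have [s' [ss' /exists_cp_naming[S Ss'] _]] := zero_addition_exists aab vs.
by apply: equivalent_trans (_ : equivalent P S) _;
  apply: directly_equivalent_equivalent; [apply: Or41|apply: Or42];
  rewrite Ss' ?Ps ?Qs.
Qed.

Lemma zero_additions_exist s (T : seq R) : a <= b ->
  (forall t, t \in T -> a <= t <= b) -> valid_terms s ->
  exists s', [/\ term_equiv s s', valid_terms s' & unzip2 s' =i T ++ unzip2 s].
Proof.
move=> ab; elim: T => [|t T IH] Tab vs.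
  by exists s; split => //; exact: term_equiv_refl.
have [|s' [ss' vs' s'E]] := IH _ vs.
  by move=> x xT; apply: Tab; rewrite inE xT orbT.
have [s'' [s's'' vs'' s''E]] := zero_addition_exists (Tab _ (mem_head _ _)) vs'.
exists s''; split => //.
  apply: term_equiv_trans vs' ss' _ => P Q Ps Qs.
  by apply: directly_equivalent_equivalent; apply: Or41; rewrite Ps Qs.
by move=> x; rewrite s''E inE s'E.
Qed.

Lemma sorted_repeat s : sorted <=%R (unzip2 s) -> ~~ sorted <%R (unzip2 s) ->
  exists u v c c' t, s = u ++ (c, t) :: (c', t) :: v.
Proof.
elim: s => [//|[c t] s IH].
case: s IH => [//|[c' t'] s] IH /= /andP[tt' ss'].
rewrite negb_and -leNgt => /orP[t't|nss'].
  exists [::], s, c, c', t.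
  by rewrite (_ : t' = t)//; apply: le_anti; rewrite tt' t't.
have [u [v [d [d' [x ->]]]]] := IH ss' nss'.
by exists ((c, t) :: u), v, d, d', x.
Qed.

(** Merging two adjacent terms with equal parameters is an equal-split read backwards; each merge
    shortens the list and keeps its set of parameters. *)
Lemma merge_terms_exists s : a <= b -> valid_terms s ->
  exists s', [/\ term_equiv s s', valid_terms s', sorted <%R (unzip2 s')
    & unzip2 s' =i unzip2 s].
Proof.
move=> ab; have [k] := ubnP (size s); elim: k s => [//|k IH] s szs vs.
have [sP s1 ss sa] := vs.
have [lts|nlts] := boolP (sorted <%R (unzip2 s)).
  by exists s; split => //; exact: term_equiv_refl.
have [u [v [c [c' [t sE]]]]] := sorted_repeat ss nlts.
pose m := u ++ (c + c', t) :: v.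
have mE : unzip2 m =i unzip2 s.
  move=> x; rewrite sE /m /unzip2 !map_cat/= !(mem_cat, inE).
  by case: (x == t); rewrite ?orbT.
have [c0 c'0 tab] : [/\ 0 <= c, 0 <= c' & a <= t <= b].
  have /andP[-> ->] : (0 <= (c, t).1) && (a <= (c, t).2 <= b).
    by apply: sP; rewrite sE mem_cat inE eqxx orbT.
  have /andP[-> _] // : (0 <= (c', t).1) && (a <= (c', t).2 <= b).
  by apply: sP; rewrite sE mem_cat !inE eqxx !orbT.
have vm : valid_terms m.
  split.
  - move=> ct; rewrite mem_cat inE orbCA => /predU1P[->/=|ctuv].
      by rewrite addr_ge0.
    apply: sP; rewrite sE mem_cat !inE.
    by case/orP: ctuv => ->; rewrite ?orbT.
  - by rewrite -[RHS]s1 sE !big_cat !big_cons/= -addrA.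
  - apply: subseq_sorted ss; first exact: le_trans.
    rewrite sE /unzip2 !map_cat/=; apply: cat_subseq => //.
    by rewrite /= eqxx; exact: subseq_cons.
  - by rewrite mE.
have [|s' [ms' vs' lts' s'E]] := IH m _ vm.
  by move: szs; rewrite sE !size_cat/=; lia.
exists s'; split => //; last by move=> x; rewrite s'E mE.
apply: term_equiv_trans vm _ ms' => P Q Ps Qs.
apply: directly_equivalent_equivalent; apply: Or44; rewrite Ps Qs.
by exists u, v, (c + c'), c, c', t.
Qed.

Lemma eval_naming_integral M (P : 'rV[R]_(M + M)) (i : 'I_N) :
  eval_naming N P 0 i = discrete_integral (vec_terms P) 'X^(i.+1).
Proof.
rewrite eval_vec_terms summxE; apply: eq_bigr => ct _.
by rewrite !mxE hornerXn.
Qed.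

(** Total mass 1 on both sides supplies the missing moment of order 0. *)
Lemma eq_discrete_integral s s' : valid_terms s -> valid_terms s' ->
  (forall i : 'I_N, discrete_integral s 'X^(i.+1) = discrete_integral s' 'X^(i.+1)) ->
  forall f : {poly R}, (size f <= N.+1)%N ->
  discrete_integral s f = discrete_integral s' f.
Proof.
move=> [_ s1 _ _] [_ s'1 _ _] ss' f szf.
have int1 u : discrete_integral u 'X^0 = \sum_(ct <- u) ct.1.
  by apply: eq_bigr => ct _; rewrite expr0 hornerC mulr1.
rewrite -[f]coefK poly_def !linear_sum; apply: eq_bigr => i _.
rewrite !linearZ; congr (_ * _).
case: i => [[|i] fi]/=; first by rewrite !int1 s1 s'1.
have iN : (i < N)%N by rewrite -ltnS; exact: leq_trans szf.
exact: (ss' (Ordinal iN)).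
Qed.

Lemma eval_naming_equivalent P Q : a <= b ->
  size (terms P) = uphalf N.+1 -> size (terms Q) = uphalf N.+1 ->
  eval_naming N (cp_vec P) = eval_naming N (cp_vec Q) -> equivalent P Q.
Proof.
move=> ab szP szQ PQ.
(* Normal form: zero terms are added at the parameters [T], then equal parameters are merged. *)
have normal (S : cp_naming N a b) (T : seq R) : (forall t, t \in T -> a <= t <= b) ->
    exists s, [/\ term_equiv (terms S) s, valid_terms s,
      sorted <%R (unzip2 s) & unzip2 s =i T ++ unzip2 (terms S)].
  move=> Tab; have vS := valid_cp_terms S.
  have [s [Ss vs sE]] := zero_additions_exist ab Tab vS.
  have [s' [ss' vs' lts' s'E]] := merge_terms_exists ab vs.
  exists s'; split => //; first exact: term_equiv_trans vs Ss ss'.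
  by move=> x; rewrite s'E sE.
have ab_terms (S : cp_naming N a b) t : t \in unzip2 (terms S) -> a <= t <= b.
  by move=> /mapP[ct ctS ->]; have [/(_ _ ctS)/andP[]] := valid_cp_terms S.
(* Each naming receives the parameters of the other, so [u] and [v] have the same ones. *)
have [u [Pu vu ltu uE]] := normal P _ (ab_terms Q).
have [v [Qv vv ltv vE]] := normal Q _ (ab_terms P).
suff uv : u = v.
  have [S Su] := exists_cp_naming vu.
  apply: equivalent_trans (Pu _ _ erefl Su) _.
  by apply: equivalent_sym; apply: Qv => //; rewrite Su.
have [[U Uu] [V Vv]] := (exists_cp_naming vu, exists_cp_naming vv).
have [PU QV] := (Pu _ _ erefl Uu, Qv _ _ erefl Vv).
apply: discrete_integral_inj.
- exact: lt_sorted_uniq.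
- apply: lt_sorted_eq => // x.
  by rewrite uE vE !mem_cat orbC.
(* Passing to the normal forms preserves evaluation, so [u] and [v] share their moments of order 1
   to [N]. It remains to bound the number of parameters of [u] by [N + 1]. *)
move=> f szf; apply: eq_discrete_integral => // [i|].
  rewrite -Uu -Vv -!eval_naming_integral.
  by rewrite -(eval_equivalent PU) -(eval_equivalent QV) PQ.
apply: leq_trans szf _; rewrite -(size_map snd).
have szu (T : seq R) : {subset unzip2 u <= T} -> (size (unzip2 u) <= size T)%N.
  by apply: uniq_leq_size; exact: lt_sorted_uniq.
have sz2 (S : cp_naming N a b) :
    size (terms S) = uphalf N.+1 -> size (unzip2 (terms S)) = uphalf N.+1.
  by move=> <-; exact: size_map.
have [oN|eN] := boolP (odd N).
  apply: leq_trans (szu (unzip2 (terms Q) ++ unzip2 (terms P)) _) _.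
    by move=> x; rewrite uE.
  by rewrite size_cat !sz2// uphalf_half/= oN; lia.
(* Each naming has [(N + 2) / 2] terms here, one too many in total for the bound; the shared
   parameter [a] is counted once, leaving [1 + 2 * (N / 2)]. *)
have aP (S : cp_naming N a b) : a \in unzip2 (terms S).
  by have [_ _ _ /(_ eN)] := valid_cp_terms S.
apply: leq_trans (szu (a :: rem a (unzip2 (terms Q)) ++ rem a (unzip2 (terms P))) _) _.
  move=> x; rewrite uE !(mem_cat, inE).
  rewrite (perm_mem (perm_to_rem (aP P))) (perm_mem (perm_to_rem (aP Q))) !inE.
  by case: eqP.
rewrite /= size_cat !size_rem// !sz2// uphalf_half/= eN.
lia.
Qed.

End ValidTerms.

Local Open Scope classical_set_scope.

(** * Surjectivity: from the convex hull to a naming *)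

(** The finite combinations form a convex set containing the curve, and the hull is the smallest
    such set. *)
Lemma conv_curve_finite (R : realType) (N : nat) (a b : R) (v : 'rV[R]_N) :
  conv_curve N a b v -> exists s : seq (R * R),
  [/\ forall ct, ct \in s -> (0 <= ct.1) && (a <= ct.2 <= b),
      \sum_(ct <- s) ct.1 = 1
    & v = \sum_(ct <- s) ct.1 *: moment_curve N ct.2].
Proof.
pose B : set 'rV[R]_N := [set v | exists s : seq (R * R),
  [/\ forall ct, ct \in s -> (0 <= ct.1) && (a <= ct.2 <= b),
      \sum_(ct <- s) ct.1 = 1
    & v = \sum_(ct <- s) ct.1 *: moment_curve N ct.2]].
apply: (_ : _ `<=` B) v; apply: smallest_sub; last first.
  move=> _ [t + <-]; rewrite /= in_itv/= => tab; exists [:: (1, t)].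
  rewrite !big_seq1 scale1r; split => //.
  by move=> ct; rewrite inE => /eqP->; rewrite ler01.
move=> x y l; rewrite !inE => -[s [sP s1 xE]] [s' [s'P s'1 yE]].
pose scale (k : R) (u : seq (R * R)) := [seq (k * ct.1, ct.2) | ct <- u].
have scaleP k u : 0 <= k ->
    (forall ct, ct \in u -> (0 <= ct.1) && (a <= ct.2 <= b)) ->
    forall ct, ct \in scale k u -> (0 <= ct.1) && (a <= ct.2 <= b).
  by move=> k0 uP _ /mapP[ct /uP/andP[c0 tab] ->]/=; rewrite mulr_ge0.
exists (scale l%:num s ++ scale (1 - l%:num) s'); split.
- move=> ct; rewrite mem_cat => /orP[].
    exact: scaleP.
  by apply: scaleP => //; rewrite subr_ge0.
- rewrite big_cat !big_map/= -!mulr_sumr s1 s'1 !mulr1.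
  by rewrite addrC subrK.
rewrite big_cat !big_map/= xE yE.
under eq_bigr do rewrite -scalerA.
under [X in _ = _ + X]eq_bigr do rewrite -scalerA.
by rewrite -!scaler_sumr.
Qed.

Lemma Nam_surjective (R : realType) (N : nat) (a b : R) (v : 'rV[R]_N) :
  a <= b -> conv_curve N a b v -> exists P : Nam N a b, eval_naming N (val P) = v.
Proof.
move=> ab /conv_curve_finite[s [sP s1 ->]].
have s_ge0 ct : ct \in s -> 0 <= ct.1 by move=> /sP/andP[].
have s_ab ct : ct \in s -> a <= ct.2 <= b by move=> /sP/andP[].
have [s' [szs' s'P s'a ss']] := gauss_radau_quadrature N ab s_ge0 s_ab.
(* Zero weights at [a] bring the quadrature to the exact size required, and sorting by parameter
   makes it a naming. *)
pose z := s' ++ nseq (uphalf N.+1 - size s') (0, a).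
pose u := sort (relpre snd <=%R) z.
have uz : perm_eq u z by rewrite perm_sort.
have intu f : discrete_integral u f = discrete_integral s' f.
  rewrite /discrete_integral (perm_big _ uz) big_cat/= [X in _ + X]big1_seq ?addr0//.
  by move=> ct; rewrite mem_nseq => /andP[_ /andP[_ /eqP->]]; rewrite mul0r.
have int1 w : discrete_integral w 1 = \sum_(ct <- w) ct.1 :> R.
  by apply: eq_bigr => ct _; rewrite hornerC mulr1.
have vu : valid_terms N a b u.
  split.
  - move=> ct; rewrite (perm_mem uz) mem_cat mem_nseq.
    by case/orP => [/s'P//|/andP[_ /eqP->]]; rewrite lexx/= lexx.
  - by rewrite -int1 intu -ss' ?int1// size_poly1.
  - by rewrite /unzip2 -sort_map sort_le_sorted.
  - move=> /s'a; rewrite (perm_mem (perm_map snd uz)) /unzip2 map_cat mem_cat.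
    by move=> ->.
have szu : size u = uphalf N.+1.
  by rewrite (perm_size uz) size_cat size_nseq subnKC.
have [P Pu] := exists_Nam vu szu.
exists P; apply/rowP => i.
rewrite eval_naming_integral Pu intu -ss'; last by rewrite size_polyXn ltnS.
by rewrite summxE; apply: eq_bigr => ct _; rewrite !mxE hornerXn.
Qed.

(** * General topology: subspaces, Hausdorff spaces, homeomorphisms *)

Lemma row_continuous (T : topologicalType) (R : realType) (n : nat)
    (f : T -> 'rV[R]_n) :
  (forall i, continuous (fun x => f x 0 i)) -> continuous f.
Proof.
move=> cf x A [P nP sPA].
have : \forall y \near x, forall i, P 0 i (f y 0 i).
  by apply: filter_forall => i; exact: (cf i x (P 0 i) (nP 0 i)).
by apply: filterS => y Py; apply: sPA => i j; rewrite ord1.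
Qed.

(** A filter on the subtype is pushed forward along [val]. Its cluster point in [A] is a cluster
    point in the subtype, whose open sets are preimages of open sets. *)
Lemma compact_set_type (T : topologicalType) (A : set T) :
  compact A -> compact [set: A].
Proof.
move=> cA F FF _.
have FA : (val @ F) A.
  by apply: (@filterS _ F _ setT); [move=> x _; exact: set_valP|exact: filterT].
have [p [Ap clp]] := cA _ _ FA.
exists (exist _ p (mem_set Ap)); split => // U V FU.
move=> [_ [[W oW <-] Wp WV]].
have FU' : (val @ F) (val @` U) 
  by apply: (@filterS _ F _ U) => // x Ux; exists x.
have [_ [[x Ux <-] Wx]] := clp _ _ FU' (open_nbhs_nbhs (conj oW Wp)).
by exists x; split => //; apply: WV.
Qed.

(** Points that neighbourhoods cannot separate have, under each continuous [f i], images that cannot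
    be separated either. *)
Lemma separating_hausdorff (T U : topologicalType) (I : Type) (f : I -> T -> U) :
  hausdorff_space U -> (forall i, continuous (f i)) ->
  (forall p q, (forall i, f i p = f i q) -> p = q) -> hausdorff_space T.
Proof.
move=> hU cf finj p q pq; apply: finj => i; apply: hU => A B Ap Bq.
have [x [Ax Bx]] := pq _ _ (cf i _ _ Ap) (cf i _ _ Bq).
by exists (f i x).
Qed.

(** The preimage of a closed set under the inverse is its image under [f], which is compact, hence
    closed. *)
Lemma compact_hausdorff_homeomorphism (X Y : topologicalType) (f : X -> Y) :
  compact [set: X] -> hausdorff_space Y -> continuous f -> injective f ->
  (forall y, exists x, f x = y) -> homeomorphism f.
Proof.
move=> cX hY cf finj /choice[g gK]; split => //; exists g; split => //.
  by move=> x; apply: finj; rewrite gK.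
apply/continuous_closedP => A cA.
have -> : g @^-1` A = f @` A.
  rewrite predeqE => y; split => [Agy|[x Ax <-]]; first by exists (g y).
  by rewrite /preimage/= (finj _ _ (gK (f x))).
apply: compact_closed => //; apply: continuous_compact.
  exact: continuous_subspaceT.
exact: subclosed_compact cA cX _.
Qed.

(** * Compactness and continuity for spaces of namings *)

Section NamTopology.
Context (R : realType) (N : nat) (a b : R).

Lemma Nam_compact : compact (Nam N a b).
Proof.
pose M := uphalf N.+1.
(* One interval contains both [[0, 1]], for the coefficients, and [[a, b]], for the parameters. *)
pose box := [set P : 'rV[R]_(M + M) |
  forall i, `[Num.min 0 a, Num.max 1 b] (P ord0 i)].
have cbox : compact box.
  apply: (@rV_compact R (M + M) (fun=> `[Num.min 0 a, Num.max 1 b])) => _.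
  exact: segment_compact.
apply: subclosed_compact cbox _; last first.
  move=> P [[c0 c1 _ tP] _] i; rewrite /= in_itv/= ge_min le_max.
  have [j ->|j ->] := split_ordP i.
    have -> : P 0 (lshift M j) = coefficient P j by [].
    rewrite c0/= -c1 (bigD1 j)//= lerDl sumr_ge0// orbT.
  have -> : P 0 (rshift M j) = parameter P j by [].
  by have /andP[-> ->] := tP j; rewrite !orbT.
have cl_le (f g : 'rV[R]_(M + M) -> R) : continuous f -> continuous g ->
    closed [set P | f P <= g P].
  move=> cf cg.
  rewrite (_ : [set P | _] = (g \- f) @^-1` [set x | 0 <= x]); last first.
    by rewrite predeqE => P /=; rewrite subr_ge0.
  apply: preimage_closed; [move=> P _|exact: closed_ge].
  by apply: continuousB; [exact: cg|exact: cf].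
have cl_forall (I : Type) (Q : I -> set 'rV[R]_(M + M)) :
    (forall i, closed (Q i)) -> closed [set P | forall i, Q i P].
  move=> clQ; rewrite (_ : [set P | _] = \bigcap_i Q i); last first.
    by rewrite predeqE => P; split=> [QP i _|QP i]; exact: QP.
  by apply: closed_bigI => i _; exact: clQ.
have cst (x : R) : continuous (fun _ : 'rV[R]_(M + M) => x).
  exact: cst_continuous.
have cc j : continuous (fun P : 'rV[R]_(M + M) => coefficient P j).
  exact: coord_continuous.
have cp j : continuous (fun P : 'rV[R]_(M + M) => parameter P j).
  exact: coord_continuous.
have csum : continuous (fun P : 'rV[R]_(M + M) => \sum_j coefficient P j).
  by apply: continuous_big => //; exact: add_continuous.
(* Every condition becomes a weak inequality between continuous functions. The sum condition splits
   in two; of [t_1 = a] only [t_1 <= a] is kept, the converse being among the bounds. Hypotheses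
   such as [i <= j] serve as indices of intersections. *)
have -> : Nam N a b =
  [set P | forall j, 0 <= coefficient P j] `&`
  ([set P | 1 <= \sum_j coefficient P j] `&` [set P | \sum_j coefficient P j <= 1]) `&`
  [set P | forall (i j : 'I_M) (ij : (i <= j)%N), parameter P i <= parameter P j] `&`
  ([set P | forall j, a <= parameter P j] `&` [set P | forall j, parameter P j <= b]) `&`
  [set P | forall (oN : odd N.+1) (j : 'I_M) (j0 : j = 0%N :> nat), parameter P j <= a].
  rewrite predeqE => P; split=> [[[c0 c1 tP abP] oP]|
      [[[[c0 [c1 c1']] tP] [aP bP]] oP]].
    split; last by move=> oN j j0; rewrite oP.
    split; last by split=> j; have /andP[] := abP j.
    by split => //; split => //=; rewrite c1.
  split.
    split => // [|j]; last by rewrite aP bP.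
    by apply: le_anti; rewrite c1 c1'.
  by move=> oN j j0; apply: le_anti; rewrite oP// aP.
apply: closedI; first apply: closedI; first apply: closedI; first apply: closedI.
- by apply: (@cl_forall _ _) => j; apply: (cl_le (fun=> 0)).
- by apply: closedI; [apply: (cl_le (fun=> 1))|apply: (cl_le _ (fun=> 1))].
- apply: (@cl_forall _ _) => i; apply: (@cl_forall _ _) => j.
  apply: (@cl_forall _ _) => _.
  by apply: (cl_le (fun P => parameter P i)).
- by apply: closedI; apply: (@cl_forall _ _) => j;
    [apply: (cl_le (fun=> a))|apply: (cl_le _ (fun=> b))].
apply: (@cl_forall _ _) => _; apply: (@cl_forall _ _) => j.
apply: (@cl_forall _ _) => _.
by apply: (cl_le _ (fun=> a)).
Qed.

Lemma eval_naming_continuous M :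
  continuous (@eval_naming R N M).
Proof.
apply: row_continuous => i.
rewrite (_ : (fun _ => _) = (fun P : 'rV[R]_(_ + _) =>
  \sum_j coefficient P j * parameter P j ^+ i.+1)); last first.
  by apply/funext => x; rewrite summxE; apply: eq_bigr => j _; rewrite !mxE.
apply: continuous_big; first exact: add_continuous.
move=> j _ x.
apply: (@continuousM _ _ (fun P : 'rV[R]_(M + M) => coefficient P j)
  (fun P : 'rV[R]_(M + M) => parameter P j ^+ i.+1)); first exact: coord_continuous.
apply: (@continuous_comp _ _ _ (fun P : 'rV[R]_(M + M) => parameter P j)
  (fun y : R => y ^+ i.+1)).
  exact: coord_continuous.
exact: exprn_continuous.
Qed.

Lemma FNam_continuous : continuous (@FNam R N a b).
Proof.
apply: continuous_comp_initial.
move=> P; apply: (@continuous_comp _ _ _ set_val (@eval_naming R N _)).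
  exact: initial_continuous.
exact: eval_naming_continuous.
Qed.

Lemma conv_curve_hausdorff : hausdorff_space (conv_curve N a b).
Proof.
apply: (@separating_hausdorff _ R 'I_N (fun i (v : conv_curve N a b) => val v 0 i)).
- exact: Rhausdorff.
- move=> i v; apply: (@continuous_comp _ _ _ set_val (fun u : 'rV[R]_N => u 0 i)).
    exact: initial_continuous.
  exact: coord_continuous.
by move=> p q pq; apply: val_inj; apply/rowP.
Qed.

Lemma QNam_compact : compact [set: QNam N a b].
Proof.
rewrite (_ : [set: _] = (\pi_(QNam N a b))%qT @` [set: Nam N a b]).
  apply: continuous_compact; last exact/compact_set_type/Nam_compact.
  by apply: continuous_subspaceT; exact: pi_continuous.
by rewrite predeqE => x; split=> // _; exists (repr x) => //; rewrite reprK.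
Qed.

Lemma FQNam_injective : a <= b -> injective (@FQNam R N a b).
Proof.
move=> ab x y; rewrite -[x]reprK -[y]reprK !FQNam_pi => /(congr1 val)/= xy.
apply/eqmodP/asboolP; apply: eval_naming_equivalent => //; exact: size_vec_terms.
Qed.

End NamTopology.

Theorem lemma29 (R : realType) (N : nat) (tmin tmax : R)
  (hN : (0 < N)%N) (ht : tmin <= tmax) :
  homeomorphism (@FQNam R N tmin tmax).
Proof.
apply: compact_hausdorff_homeomorphism.
- exact: QNam_compact.
- exact: conv_curve_hausdorff.
(* Continuity on the quotient is continuity of the composite with the projection, which is
   [FNam]. *)
- apply/quotient_continuous.
  rewrite (_ : _ \o _ = @FNam R N tmin tmax); first exact: FNam_continuous.
  by apply/funext => P; exact: FQNam_pi.
- exact: FQNam_injective.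
move=> y; have [P Py] := Nam_surjective ht (set_valP y).
exists (\pi_(QNam N tmin tmax) P)%qT; rewrite FQNam_pi.
by apply: val_inj.
Qed.
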